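(* Let $X$ be a subshift over a non-empty alphabet $\mathscr{A}$ such that each cycle has an exit, let $R$ be a commutative unital ring, and let $\widetilde{\mathcal{A}}_R(X)$ be the unital subshift algebra. If $B$ is an $R$-algebra and $\Phi:\widetilde{\mathcal{A}}_R(X)\to B$ is an $R$-homomorphism (homomorphism of $R$-algebras) such that $\Phi(\gamma p_A)\neq 0$ for each $\emptyset\neq A\in\mathcal{U}$ and each $0\neq\gamma\in R$, then $\Phi$ is injective.
   Context: Conventions: $\mathbb{N}=\{0,1,2,\ldots\}$. $\mathscr{A}$ is a non-empty (possibly infinite) set, the alphabet; $\mathscr{A}^*$ is the set of finite words over $\mathscr{A}$, $\omega$ the empty word, $\beta\alpha$ concatenation, and $\alpha^\infty=\alpha\alpha\alpha\cdots$. A subshift $X\subseteq\mathscr{A}^{\mathbb{N}}$ is a set of the form $X=X_F$ for some $F\subseteq\mathscr{A}^*$, where $X_F$ is the set of all sequences in $\mathscr{A}^{\mathbb{N}}$ containing no word of $F$ as a (consecutive) subword. The language $\mathcal{L}_X$ is the set of all finite words (including $\omega$) that appear in some sequence of $X$. For $\alpha,\beta\in\mathcal{L}_X$ let $C(\alpha,\beta)=\{\beta x\in X:\alpha x\in X\}$; note $X=C(\omega,\omega)$. $\mathcal{U}$ is the Boolean algebra of subsets of $X$ generated by all $C(\alpha,\beta)$, $\alpha,\beta\in\mathcal{L}_X$. The unital subshift algebra $\widetilde{\mathcal{A}}_R(X)$ is the universal unital $R$-algebra with generators $\{p_A:A\in\mathcal{U}\}$ and $\{s_a,s_a^*:a\in\mathscr{A}\}$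 subject to: (i) $p_X=1$, $p_{A\cap B}=p_Ap_B$, $p_{A\cup B}=p_A+p_B-p_{A\cap B}$, $p_\emptyset=0$ for all $A,B\in\mathcal{U}$; (ii) $s_as_a^*s_a=s_a$ and $s_a^*s_as_a^*=s_a^*$ for all $a\in\mathscr{A}$; (iii) $s_\beta s_\alpha^*s_\alpha s_\beta^*=p_{C(\alpha,\beta)}$ for all $\alpha,\beta\in\mathcal{L}_X$, where $s_\omega=s_\omega^*=1$ and, for $\alpha=\alpha(1)\cdots\alpha(n)$, $s_\alpha=s_{\alpha(1)}\cdots s_{\alpha(n)}$ and $s_\alpha^*=s_{\alpha(n)}^*\cdots s_{\alpha(1)}^*$. For $A\in\mathcal{U}$ and $\alpha\in\mathcal{L}_X$ the relative range is $r(A,\alpha)=\{x\in X:\alpha x\in A\}$. A cycle is a pair $(A,\alpha)$ with $\alpha\in\mathcal{L}_X\setminus\{\omega\}$, $\emptyset\neq A\in\mathcal{U}$ and $A\subseteq r(A,\alpha)$. A cycle $(A,\alpha)$ has an exit if $A\neq\{\alpha^\infty\}$.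
   Formalization: The formal theorem also assumes that, when X is nonempty, every letter of the alphabet occurs in X; otherwise, for R nonzero, sending s_a and s_a^* to 0 for a letter a not occurring in X gives a non-injective homomorphism that keeps every nonzero γp_A. *)

(* Defs.v *)
From HB Require Import structures.
From mathcomp Require Import all_boot all_algebra.
From mathcomp Require Import boolp classical_sets.

Set Implicit Arguments.
Unset Strict Implicit.
Unset Printing Implicit Defensive.

Import GRing.Theory.
Local Open Scope classical_set_scope.
Local Open Scope ring_scope.
Local Open Scope quotient_scope.

(* Associative R-algebras that need not have a unit, and unital ones that may
   be the zero ring: algType excludes both. *)
Definition algebra_law (R : pzRingType) (B : lmodType R) (m : B -> B -> B) :=
  [/\ associative m, left_distributive m +%R, right_distributive m +%R,
      forall (k : R) x y, m (k *: x) y = k *: m x y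
    & forall (k : R) x y, m x (k *: y) = k *: m x y].

Definition unital_algebra_law (R : pzRingType) (B : lmodType R)
    (m : B -> B -> B) (e : B) :=
  [/\ algebra_law m, left_id e m & right_id e m].

(* The universal unital R-algebra with generators G subject to the relations
   t = u for rel t u: formal expressions modulo the congruence generated by
   the axioms of unital R-algebras and by rel. *)
Section Presentation.
Variables (R : comPzRingType) (G : Type).

Inductive term : Type :=
| Gen of G
| TZero
| TOne
| TOpp of term
| TAdd of term & term
| TMul of term & term
| TScale of R & term.

HB.instance Definition _ := gen_eqMixin term.
HB.instance Definition _ := gen_choiceMixin term.

Variable rel : term -> term -> Prop.

Inductive teq : term -> term -> Prop :=
| teq_rel t u : rel t u -> teq t u
| teq_refl t : teq t t
| teq_sym t u : teq t u -> teq u t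
| teq_trans t u v : teq t u -> teq u v -> teq t v
| teq_opp t t' : teq t t' -> teq (TOpp t) (TOpp t')
| teq_add t t' u u' : teq t t' -> teq u u' -> teq (TAdd t u) (TAdd t' u')
| teq_mul t t' u u' : teq t t' -> teq u u' -> teq (TMul t u) (TMul t' u')
| teq_scale k t t' : teq t t' -> teq (TScale k t) (TScale k t')
| teq_addA t u v : teq (TAdd t (TAdd u v)) (TAdd (TAdd t u) v)
| teq_addC t u : teq (TAdd t u) (TAdd u t)
| teq_add0 t : teq (TAdd TZero t) t
| teq_addN t : teq (TAdd (TOpp t) t) TZero
| teq_mulA t u v : teq (TMul t (TMul u v)) (TMul (TMul t u) v)
| teq_mul1l t : teq (TMul TOne t) t
| teq_mul1r t : teq (TMul t TOne) t
| teq_mulDl t u v : teq (TMul (TAdd t u) v) (TAdd (TMul t v) (TMul u v))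
| teq_mulDr t u v : teq (TMul t (TAdd u v)) (TAdd (TMul t u) (TMul t v))
| teq_scaleA k l t : teq (TScale k (TScale l t)) (TScale (k * l) t)
| teq_scale1 t : teq (TScale 1 t) t
| teq_scaleDr k t u :
    teq (TScale k (TAdd t u)) (TAdd (TScale k t) (TScale k u))
| teq_scaleDl k l t :
    teq (TScale (k + l) t) (TAdd (TScale k t) (TScale l t))
| teq_scaleAl k t u : teq (TScale k (TMul t u)) (TMul (TScale k t) u)
| teq_scaleAr k t u : teq (TScale k (TMul t u)) (TMul t (TScale k u)).

Definition teqb (t u : term) : bool := `[< teq t u >].

Lemma teqb_equiv : equiv_class_of teqb.
Proof.
split=> [t|t u|u t v].
- by apply/asboolP; apply: teq_refl.
- by apply/asboolP/asboolP => /teq_sym.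
- by move=> /asboolP tu /asboolP uv; apply/asboolP; apply: teq_trans tu uv.
Qed.

Canonical teqb_equivRel := EquivRelPack teqb_equiv.

Definition presented := {eq_quot teqb}.

HB.instance Definition _ := Choice.on presented.
HB.instance Definition _ : EqQuotient _ teqb presented :=
  EqQuotient.on presented.

Definition cls (t : term) : presented := \pi_presented t.

Lemma clsE t u : cls t = cls u <-> teq t u.
Proof.
split=> [/eqmodP|tu]; first by move/asboolP.
by apply/eqmodP/asboolP.
Qed.

Lemma cls_repr (x : presented) : cls (repr x) = x.
Proof. exact: reprK. Qed.

Lemma repr_cls t : teq (repr (cls t)) t.
Proof. by apply/clsE; rewrite cls_repr. Qed.

Lemma cls_ind (P : presented -> Prop) : (forall t, P (cls t)) -> forall x, P x.
Proof. by move=> H x; rewrite -(cls_repr x). Qed.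

Definition pzero := cls TZero.
Definition pone := cls TOne.
Definition popp (x : presented) := cls (TOpp (repr x)).
Definition padd (x y : presented) := cls (TAdd (repr x) (repr y)).
Definition pmul (x y : presented) := cls (TMul (repr x) (repr y)).
Definition pscale k (x : presented) := cls (TScale k (repr x)).

Lemma poppE t : popp (cls t) = cls (TOpp t).
Proof. by apply/clsE; apply: teq_opp; apply: repr_cls. Qed.
Lemma paddE t u : padd (cls t) (cls u) = cls (TAdd t u).
Proof. by apply/clsE; apply: teq_add; apply: repr_cls. Qed.
Lemma pmulE t u : pmul (cls t) (cls u) = cls (TMul t u).
Proof. by apply/clsE; apply: teq_mul; apply: repr_cls. Qed.
Lemma pscaleE k t : pscale k (cls t) = cls (TScale k t).
Proof. by apply/clsE; apply: teq_scale; apply: repr_cls. Qed.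

Let pE := (poppE, paddE, pmulE, pscaleE).

Lemma paddA : associative padd.
Proof.
elim/cls_ind=> t; elim/cls_ind=> u; elim/cls_ind=> v; rewrite !pE.
by apply/clsE; constructor.
Qed.
Lemma paddC : commutative padd.
Proof.
by elim/cls_ind=> t; elim/cls_ind=> u; rewrite !pE; apply/clsE; constructor.
Qed.
Lemma padd0 : left_id pzero padd.
Proof. by elim/cls_ind=> t; rewrite !pE; apply/clsE; constructor. Qed.
Lemma paddN : left_inverse pzero popp padd.
Proof. by elim/cls_ind=> t; rewrite !pE; apply/clsE; constructor. Qed.

HB.instance Definition _ :=
  GRing.isZmodule.Build presented paddA paddC padd0 paddN.

Lemma pmulA : associative pmul.
Proof.
elim/cls_ind=> t; elim/cls_ind=> u; elim/cls_ind=> v; rewrite !pE.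
by apply/clsE; constructor.
Qed.
Lemma pmul1l : left_id pone pmul.
Proof. by elim/cls_ind=> t; rewrite !pE; apply/clsE; constructor. Qed.
Lemma pmul1r : right_id pone pmul.
Proof. by elim/cls_ind=> t; rewrite !pE; apply/clsE; constructor. Qed.
Lemma pmulDl : left_distributive pmul padd.
Proof.
elim/cls_ind=> t; elim/cls_ind=> u; elim/cls_ind=> v; rewrite !pE.
by apply/clsE; constructor.
Qed.
Lemma pmulDr : right_distributive pmul padd.
Proof.
elim/cls_ind=> t; elim/cls_ind=> u; elim/cls_ind=> v; rewrite !pE.
by apply/clsE; constructor.
Qed.

HB.instance Definition _ :=
  GRing.Zmodule_isPzRing.Build presented pmulA pmul1l pmul1r pmulDl pmulDr.

Lemma pscaleA k l x : pscale k (pscale l x) = pscale (k * l) x.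
Proof. by elim/cls_ind: x => t; rewrite !pE; apply/clsE; constructor. Qed.
Lemma pscale1 : left_id 1 pscale.
Proof. by elim/cls_ind=> t; rewrite !pE; apply/clsE; constructor. Qed.
Lemma pscaleDr : right_distributive pscale +%R.
Proof.
move=> k; elim/cls_ind=> t; elim/cls_ind=> u.
by rewrite /GRing.add /= !pE; apply/clsE; constructor.
Qed.
Lemma pscaleDl x : {morph pscale^~ x : k l / k + l}.
Proof.
elim/cls_ind: x => t k l.
by rewrite !pE [RHS]paddE; apply/clsE; constructor.
Qed.

HB.instance Definition _ :=
  GRing.Zmodule_isLmodule.Build R presented pscaleA pscale1 pscaleDr pscaleDl.

Lemma presented_unital_algebra :
  unital_algebra_law (R := R) (B := presented) *%R 1.
Proof.
split; [split|exact: mul1r|exact: mulr1].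
- exact: mulrA.
- exact: mulrDl.
- exact: mulrDr.
- move=> k; elim/cls_ind=> t; elim/cls_ind=> u.
  by rewrite /GRing.scale /GRing.mul /= !pE; apply/clsE/teq_sym; constructor.
- move=> k; elim/cls_ind=> t; elim/cls_ind=> u.
  by rewrite /GRing.scale /GRing.mul /= !pE; apply/clsE/teq_sym; constructor.
Qed.

Definition gen (g : G) : presented := cls (Gen g).

Section Eval.
Variables (C : lmodType R) (m : C -> C -> C) (e : C) (f : G -> C).

Fixpoint teval (t : term) : C :=
  match t with
  | Gen g => f g
  | TZero => 0
  | TOne => e
  | TOpp t => - teval t
  | TAdd t u => teval t + teval u
  | TMul t u => m (teval t) (teval u)
  | TScale k t => k *: teval t
  end.

Definition satisfies_relations := forall t u, rel t u -> teval t = teval u.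

End Eval.

Lemma clsN t : cls (TOpp t) = - cls t. Proof. by rewrite -poppE. Qed.
Lemma clsD t u : cls (TAdd t u) = cls t + cls u. Proof. by rewrite -paddE. Qed.
Lemma clsM t u : cls (TMul t u) = cls t * cls u. Proof. by rewrite -pmulE. Qed.
Lemma clsZ k t : cls (TScale k t) = k *: cls t.
Proof. by rewrite -pscaleE. Qed.

Lemma teval_gen t : teval (C := presented) *%R 1 gen t = cls t.
Proof.
elim: t => //= [t ->|t -> u ->|t -> u ->|k t ->].
- by rewrite clsN.
- by rewrite clsD.
- by rewrite clsM.
- by rewrite clsZ.
Qed.

Lemma presented_relations : satisfies_relations (C := presented) *%R 1 gen.
Proof. by move=> t u tu; rewrite !teval_gen; apply/clsE; apply: teq_rel. Qed.

Lemma presented_universal (C : lmodType R) (m : C -> C -> C) (e : C)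
    (f : G -> C) :
  unital_algebra_law m e -> satisfies_relations m e f ->
  exists! h : presented -> C,
    [/\ linear h, {morph h : x y / x * y >-> m x y}, h 1 = e
      & forall g, h (gen g) = f g].
Proof.
move=> [[mA mDl mDr mZl mZr] m1l m1r] frel.
have sound t u : teq t u -> teval m e f t = teval m e f u.
  elim=> {t u} /=; intros; do ?congruence.
  - exact: frel.
  - exact: addrA.
  - exact: addrC.
  - exact: add0r.
  - exact: addNr.
  - exact: scalerA.
  - exact: scale1r.
  - exact: scalerDr.
  - exact: scalerDl.
  - by rewrite mZl.
  - by rewrite mZr.
pose phi (x : presented) := teval m e f (repr x).
exists phi.
have hE t : phi (cls t) = teval m e f t.
  by apply: sound; apply: repr_cls.
split.
  split=> [k||| g]; last 2 first.
  - exact: hE TOne.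
  - exact: hE (Gen g).
  - by elim/cls_ind=> t; elim/cls_ind=> u; rewrite -clsZ -clsD !hE.
  - by elim/cls_ind=> t; elim/cls_ind=> u; rewrite -clsM !hE.
move=> h [hL hM h1 hg]; apply/funext; elim/cls_ind=> t; rewrite hE.
have hD x y : h (x + y) = h x + h y.
  by have := hL 1 x y; rewrite !scale1r.
have h0 : h 0 = 0 by apply: (addrI (h 0)); rewrite -hD !addr0.
have hZ k x : h (k *: x) = k *: h x.
  by have := hL k x 0; rewrite h0 !addr0.
elim: t => /= [g||| t ->|t IHt u IHu|t IHt u IHu|k t ->].
- exact/esym/hg.
- exact/esym/h0.
- exact/esym/h1.
- by rewrite clsN -[in RHS]scaleN1r hZ scaleN1r.
- by rewrite clsD hD IHt IHu.
- by rewrite clsM hM IHt IHu.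
- by rewrite clsZ hZ.
Qed.

End Presentation.

Arguments Gen {R G}.
Arguments TZero {R G}.
Arguments TOne {R G}.

Section Subshift.
Variable A : pointedType.
Implicit Types (w : seq A) (x : nat -> A) (X E : set (nat -> A)).

Definition occurs w x := exists i, w = [seq x j | j <- iota i (size w)].

Definition avoiding (F : set (seq A)) : set (nat -> A) :=
  [set x | forall w, F w -> ~ occurs w x].

Definition subshift X := exists F : set (seq A), X = avoiding F.

(* When X is empty this omits the empty word; calU set0 is then {set0} either
   way. *)
Definition language X : set (seq A) := [set w | exists2 x, X x & occurs w x].

Fixpoint wcat w x : nat -> A :=
  if w is a :: w' then fun i => if i is j.+1 then wcat w' x j else a else x.

(* The periodic sequence w w w ..., meant for a nonempty word w. *)
Definition winf w : nat -> A := fun i => nth point w (i %% size w).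

(* C(alpha, beta) *)
Definition Cset X (alpha beta : seq A) : set (nat -> A) :=
  [set y | exists x, [/\ y = wcat beta x, X (wcat beta x) & X (wcat alpha x)]].

Definition boolean_algebra X (M : set (set (nat -> A))) :=
  [/\ forall E, M E -> E `<=` X, M X,
      forall E F, M E -> M F -> M (E `|` F)
    & forall E, M E -> M (X `\` E)].

Definition calU X : set (set (nat -> A)) :=
  smallest (boolean_algebra X)
    [set E | exists alpha beta,
      [/\ language X alpha, language X beta & E = Cset X alpha beta]].

(* r(E, alpha) *)
Definition relrange X E (alpha : seq A) : set (nat -> A) :=
  [set x | X x /\ E (wcat alpha x)].

Definition shift_cycle X E (alpha : seq A) :=
  [/\ language X alpha, alpha <> [::], calU X E, E !=set0
    & E `<=` relrange X E alpha].

Definition has_exit E (alpha : seq A) := E <> [set winf alpha].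

(* The generators p_E for E in calU X only, s_a, and s_a^*. *)
Inductive generator X : Type :=
| GenP E of calU X E
| GenS of A
| GenSs of A.

Section Algebra.
Variables (R : comPzRingType) (X : set (nat -> A)).

Local Notation expr := (term R (generator X)).
Local Notation P hE := (Gen (GenP hE) : expr).
Local Notation S a := (Gen (GenS X a) : expr).
Local Notation Ss a := (Gen (GenSs X a) : expr).

Fixpoint Sword w : expr :=
  if w is a :: w' then TMul (S a) (Sword w') else TOne.

(* s_w^* lists the starred letters in reverse order. *)
Fixpoint Ssword w : expr :=
  if w is a :: w' then TMul (Ssword w') (Ss a) else TOne.

Inductive subshift_rel : expr -> expr -> Prop :=
| rel_projX (hX : calU X X) : subshift_rel (P hX) TOne
| rel_projI E F (hE : calU X E) (hF : calU X F) (hEF : calU X (E `&` F)) :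
    subshift_rel (P hEF) (TMul (P hE) (P hF))
| rel_projU E F (hE : calU X E) (hF : calU X F) (hI : calU X (E `&` F))
    (hU : calU X (E `|` F)) :
    subshift_rel (P hU) (TAdd (TAdd (P hE) (P hF)) (TOpp (P hI)))
| rel_proj0 (h0 : calU X set0) : subshift_rel (P h0) TZero
| rel_SSsS a : subshift_rel (TMul (TMul (S a) (Ss a)) (S a)) (S a)
| rel_SsSSs a : subshift_rel (TMul (TMul (Ss a) (S a)) (Ss a)) (Ss a)
| rel_proj_Cset alpha beta (hC : calU X (Cset X alpha beta)) :
    language X alpha -> language X beta ->
    subshift_rel
      (TMul (TMul (TMul (Sword beta) (Ssword alpha)) (Sword alpha))
            (Ssword beta))
      (P hC).

Definition subshift_algebra := presented subshift_rel.

HB.instance Definition _ := GRing.PzRing.on subshift_algebra.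
HB.instance Definition _ := GRing.Lmodule.on subshift_algebra.

Definition proj E (hE : calU X E) : subshift_algebra :=
  gen subshift_rel (GenP hE).

End Algebra.

End Subshift.

(* Main.v *)
Require Import Defs.
From HB Require Import structures.
From mathcomp Require Import all_boot all_algebra.
From mathcomp Require Import boolp classical_sets.
Local Open Scope classical_set_scope.
Local Open Scope ring_scope.

Import GRing.Theory.

Set Implicit Arguments.
Unset Strict Implicit.

(* Uniqueness reduces to compressing: if x <> 0 in the subshift algebra, then
   some y x z equals k p_E with k <> 0 and E nonempty, so Phi x = 0 is absurd.
   Every x is a finite sum of monomials s_u d s_v^* with d in the span of the
   projections. After merging monomials indexed by (u, v) and (u f, v f), pick
   a nonzero one, with index (u0, v0): s_u0^* x s_v0 has a nonzero diagonal
   part d0, equal to a scalar k on some p_E. Compressing by p_V kills the other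
   monomials as soon as no z and no points x, y of V satisfy u0 x = u z and
   v0 y = v z. Such a nonempty V inside E exists: the question reduces to
   making V disjoint from its translate by a nonempty word d. Take
   V = E \ r(E, d) if this is nonempty; otherwise (E, d) is a cycle, its exit
   gives a point w of E other than d^infinity, and V is the part of E in the
   cylinder of d^m but not of d^(m+1), where m is maximal for w. *)

(** * Words and infinite sequences *)

Section Words.
Variable A : pointedType.
Implicit Types (a b : A) (u v w : seq A) (x y z : nat -> A).

Lemma wcat_cat u v x : wcat (u ++ v) x = wcat u (wcat v x).
Proof. by elim: u => //= a u ->. Qed.

Lemma wcat_cons_inj a b x y :
  wcat [:: a] x = wcat [:: b] y -> a = b /\ x = y.
Proof.
move=> e; split; first exact: (congr1 (@^~ 0%N) e).
by apply/funext => i; exact: (congr1 (@^~ i.+1) e).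
Qed.

Lemma wcat_inj w : injective (wcat w).
Proof. by elim: w => //= a w IH x y /(@wcat_cons_inj a a) [_ /IH]. Qed.

Lemma wcat_overlap u v x y : wcat u x = wcat v y ->
  (exists2 d, u = v ++ d & y = wcat d x) \/
  (exists2 d, v = u ++ d & x = wcat d y).
Proof.
elim: u v => [|a u IH] [|b v] /=.
- by move=> ->; left; exists [::].
- by move=> ->; right; exists (b :: v).
- by move=> <-; left; exists (a :: u).
- move=> /(@wcat_cons_inj a b) [-> /IH] [[d -> ->]|[d -> ->]].
    by left; exists d.
  by right; exists d.
Qed.

Lemma wcatE w x i :
  wcat w x i = if (i < size w)%N then nth point w i else x (i - size w)%N.
Proof. by elim: w i => [|a w IH] [|i] //=; rewrite IH ltnS subSS. Qed.

Lemma occurs_wcat w x : occurs w (wcat w x).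
Proof.
exists 0%N; apply: (@eq_from_nth _ point); rewrite ?size_map ?size_iota //.
move=> i lt.
by rewrite (nth_map 0%N) ?size_iota // nth_iota // wcatE lt.
Qed.

Definition wpow w n : seq A := flatten (nseq n w).

Lemma wpow_winf w x : w <> [::] ->
  (forall n, exists y, x = wcat (wpow w n) y) -> x = winf w.
Proof.
move=> w0 xw; apply/funext => i.
have sw : (0 < size w)%N by case: w w0 {xw}.
have pow n y : (i < n * size w)%N ->
    wcat (wpow w n) y i = nth point w (i %% size w).
  elim: n i y => [|n IH] //= j y lt.
  rewrite wcat_cat wcatE; case: ltnP => [jw|wj]; first by rewrite modn_small.
  rewrite IH; first by rewrite -{2}(subnK wj) modnDr.
  by rewrite ltn_subLR // addnC addnC -mulSn.
(* Position i lies within the first i + 1 copies, since each copy has length at least 1. *)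
have [y ->] := xw i.+1; apply: pow.
by rewrite mulSn -[X in (X < _)%N]add0n -addSn leq_add // leq_pmulr.
Qed.

End Words.

(** * The Boolean algebra of a subshift *)

Section Sets.
Variables (A : pointedType) (X : set (nat -> A)).
Implicit Types (a b : A) (u v w : seq A) (x y z : nat -> A).
Implicit Types (E F V W : set (nat -> A)).

(** The subsets of X form a Boolean algebra containing the generators, and [calU X] lies inside
    every such algebra. *)
Lemma calU_sub E : calU X E -> E `<=` X.
Proof.
move=> /(_ [set E | E `<=` X]); apply; split.
  split=> [E1 //|//|E1 E2 s1 s2 x /= [/s1|/s2]//|E1 s1 x []//].
by move=> _ [u [v [_ _ ->]]] y [x [-> ]].
Qed.

Lemma calU_algebra : boolean_algebra X (calU X).
Proof.
split=> [|M [[]]//|E F UE UF M M1|E UE M M1].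
- exact: calU_sub.
- by have [[_ _ MU _] _] := M1; apply: MU; [apply: UE|apply: UF].
- by have [[_ _ _ MC] _] := M1; apply: MC; apply: UE.
Qed.

Lemma calU_T : calU X X.
Proof. by have [] := calU_algebra. Qed.

Lemma calU_U E F : calU X E -> calU X F -> calU X (E `|` F).
Proof. by have [_ _ + _] := calU_algebra; exact. Qed.

Lemma calU_C E : calU X E -> calU X (X `\` E).
Proof. by have [_ _ _] := calU_algebra; exact. Qed.

Lemma calU_0 : calU X set0.
Proof. by rewrite -(setDv X); apply: calU_C; exact: calU_T. Qed.

Lemma calU_I E F : calU X E -> calU X F -> calU X (E `&` F).
Proof.
move=> UE UF; have -> : E `&` F = X `\` ((X `\` E) `|` (X `\` F)).
  rewrite setDUr !setDD (setIidr (calU_sub UE)).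
  by rewrite (setIidr (calU_sub UF)).
by do ![apply: calU_C => //|apply: calU_U].
Qed.

Lemma calU_D E F : calU X E -> calU X F -> calU X (E `\` F).
Proof.
move=> UE UF; rewrite -(setIidl (calU_sub UE)) -setIDA.
by apply: calU_I => //; apply: calU_C.
Qed.

Lemma calU_Cset u v : language X u -> language X v -> calU X (Cset X u v).
Proof. by move=> Lu Lv M [_]; apply; exists u, v. Qed.

Lemma calU_ind (Q : set (nat -> A) -> Prop) :
  Q X ->
  (forall u v, language X u -> language X v -> Q (Cset X u v)) ->
  (forall E F, calU X E -> calU X F -> Q E -> Q F -> Q (E `|` F)) ->
  (forall E, calU X E -> Q E -> Q (X `\` E)) ->
  forall E, calU X E -> Q E.
Proof.
move=> QX QC QU QD E UE.
suff [] : [set F | calU X F /\ Q F] E by [].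
apply: UE; split; first split.
- by move=> F [/calU_sub].
- by split=> //; exact: calU_T.
- by move=> F G [UF QF] [UG QG]; split; [exact: calU_U|exact: QU].
- by move=> F [UF QF]; split; [exact: calU_C|exact: QD].
move=> _ [u [v [Lu Lv ->]]]; split; [exact: calU_Cset|exact: QC].
Qed.

(** The image of E under the partial injection x -> w x, whose preimage map is [relrange]; [X y] is
    imposed because w x may leave X. *)
Definition prepend E w : set (nat -> A) :=
  [set y | X y /\ exists2 x, E x & y = wcat w x].

(** * Closure of the Boolean algebra under relative ranges and prefixing *)

Hypotheses (hX : subshift X) (X0 : X !=set0).

Lemma subshift_behead a x : X (wcat [:: a] x) -> X x.
Proof.
have [F ->] := hX => ax w Fw [i wE]; apply: (ax w Fw); exists i.+1.
by rewrite {1}wE -[i.+1]add1n iotaDl -map_comp.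
Qed.

Lemma subshift_drop w x : X (wcat w x) -> X x.
Proof. by elim: w => //= a w IH /(@subshift_behead a)/IH. Qed.

Lemma language_wcat w x : X (wcat w x) -> language X w.
Proof. by move=> Xwx; exists (wcat w x) => //; exact: occurs_wcat. Qed.

Lemma language_nil : language X [::].
Proof. by have [x Xx] := X0; exact: (@language_wcat _ x). Qed.

Lemma language_behead a w : language X (a :: w) -> language X w.
Proof. by move=> [x Xx [i /= [_ wE]]]; exists x => //; exists i.+1. Qed.

Lemma prepend_nil E : calU X E -> prepend E [::] = E.
Proof.
move=> UE; apply/seteqP; split=> [y [_ [x Ex ->]]//|y Ey].
by split; [exact: calU_sub Ey|exists y].
Qed.

Lemma prepend_cons E a w :
  prepend E (a :: w) = prepend (prepend E w) [:: a].
Proof.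
apply/seteqP; split=> [y [Xy [x Ex yE]]|y [Xy [_ [_ [x Ex ->]] yE]]].
  split=> //; exists (wcat w x) => //; split; last by exists x.
  by apply: (@subshift_behead a); rewrite yE in Xy.
by split=> //; exists x.
Qed.

Lemma relrange_nil E : calU X E -> relrange X E [::] = E.
Proof.
move=> UE; apply/seteqP; split=> [y []//|y Ey].
by split=> //; exact: calU_sub Ey.
Qed.

Lemma relrange_cons E a w : calU X E ->
  relrange X E (a :: w) = relrange X (relrange X E [:: a]) w.
Proof.
move=> UE; apply/seteqP; split=> y /= [Xy].
  move=> Ey; split=> //; split=> //; apply: (@subshift_behead a).
  exact: calU_sub Ey.
by move=> [].
Qed.

Lemma prepend_Cset a u v : prepend (Cset X u v) [:: a] = Cset X u (a :: v).
Proof.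
apply/seteqP; split=> y.
  by move=> [Xy [_ [x [-> Xv Xu]] yE]]; rewrite yE in Xy *; exists x.
move=> [x [-> Xv Xu]]; split=> //; exists (wcat v x) => //.
by exists x; split=> //; exact: subshift_behead Xv.
Qed.

Lemma Cset_nonlanguage u v : ~ language X v -> Cset X u v = set0.
Proof.
by move=> Lv; rewrite -subset0 => y [x [_ Xv _]]; apply: Lv (language_wcat Xv).
Qed.

Lemma prependX a : prepend X [:: a] = Cset X [::] [:: a].
Proof.
apply/seteqP; split=> [y [Xy [x Xx yE]]|y [x [-> Xa Xx]]].
  by rewrite yE in Xy *; exists x.
by split=> //; exists x.
Qed.

Lemma relrangeX a : relrange X X [:: a] = Cset X [:: a] [::].
Proof.
by apply/seteqP; split=> [y [Xy Xa]|y [x [-> Xa Xx]]//]; exists y.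
Qed.

Lemma prependU E F w : prepend (E `|` F) w = prepend E w `|` prepend F w.
Proof.
apply/seteqP; split=> [y [Xy [x [Ex|Fx] yE]]|y [[Xy [x Ex yE]]|[Xy [x Ex yE]]]].
- by left; split=> //; exists x.
- by right; split=> //; exists x.
- by split=> //; exists x => //; left.
- by split=> //; exists x => //; right.
Qed.

Lemma prependC E w :
  prepend (X `\` E) w = prepend X w `\` prepend E w.
Proof.
apply/seteqP; split=> y.
  move=> [Xy [x [Xx Ex] yE]]; split; first by split=> //; exists x.
  by rewrite yE => - [_ [z Ez /wcat_inj xz]]; apply: Ex; rewrite xz.
move=> [[Xy [x Xx yE]] nE]; split=> //; exists x => //; split=> // Ex.
by apply: nE; split=> //; exists x.
Qed.

Lemma relrange_Cset_nil a u : relrange X (Cset X u [::]) [:: a] =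
  Cset X (u ++ [:: a]) [::].
Proof.
apply/seteqP; split=> [y [Xy [x [/= <- Xa Xu]]]|y [x [-> Xx Xu]]].
  by exists y; rewrite wcat_cat.
rewrite wcat_cat in Xu; split=> //=.
by exists (wcat [:: a] x); split=> //; exact: subshift_drop Xu.
Qed.

(** The factor C(a, omega) keeps the requirement that a y lie in X, which C(u, v) does not
    record. *)
Lemma relrange_Cset_cons a b u v : relrange X (Cset X u (b :: v)) [:: a] =
  if a == b then Cset X u v `&` Cset X [:: a] [::] else set0.
Proof.
case: eqP => [<-|ab]; last first.
  by rewrite -subset0 => y [_ [x [/(@wcat_cons_inj _ a b)[/ab]]]].
apply/seteqP; split=> y.
  move=> [Xy [x [/(@wcat_cons_inj _ a a) [_ yE] Xv Xu]]]; subst y.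
  by split; [exists x; split|exists (wcat v x); split].
move=> [[x [yE Xv Xu]] [x' [/= yE' Xx' Xa]]]; rewrite -yE' in Xx' Xa.
by split=> //; exists x; rewrite yE in Xa *.
Qed.

Lemma relrangeU E F w :
  relrange X (E `|` F) w = relrange X E w `|` relrange X F w.
Proof.
by apply/seteqP; split=> y; rewrite /relrange /setU /=; tauto.
Qed.

Lemma relrangeC E w :
  relrange X (X `\` E) w = relrange X X w `\` relrange X E w.
Proof.
by apply/seteqP; split=> y; rewrite /relrange /setD /=; tauto.
Qed.

Lemma calU_Cset_nil u : calU X (Cset X u [::]).
Proof.
have [Lu|nLu] := pselect (language X u).
  by apply: calU_Cset => //; exact: language_nil.
have -> : Cset X u [::] = set0; last exact: calU_0.
by rewrite -subset0 => y [x [_ _ Xu]]; apply: nLu (language_wcat Xu).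
Qed.

Lemma calU_relrange E w : calU X E -> calU X (relrange X E w).
Proof.
(* Peeling off letters reduces to one letter, where the operation commutes with unions and turns
   complements into differences, so that induction over [calU] applies. *)
suff U1 a F : calU X F -> calU X (relrange X F [:: a]).
  elim: w E => [|a w IH] E UE; first by rewrite relrange_nil.
  by rewrite relrange_cons //; apply: IH; apply: U1.
move: F; apply: calU_ind => [|u v Lu Lv|E1 E2 _ _ U1 U2|E1 _ U1].
- by rewrite relrangeX; exact: calU_Cset_nil.
- case: v Lv => [|b v] Lv.
    by rewrite relrange_Cset_nil; exact: calU_Cset_nil.
  rewrite relrange_Cset_cons; case: ifP => _; last exact: calU_0.
  apply: calU_I; last exact: calU_Cset_nil.
  by apply: calU_Cset => //; exact: language_behead Lv.
- by rewrite relrangeU; exact: calU_U.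
- by rewrite relrangeC relrangeX; apply: calU_D => //; exact: calU_Cset_nil.
Qed.

Lemma prepend_relrange E w : calU X E ->
  prepend (relrange X E w) w = E `&` prepend X w.
Proof.
move=> UE; apply/seteqP; split=> [y [Xy [x [Xx Ex] yE]]|y [Ey [Xy [x Xx yE]]]].
  by rewrite yE in Xy *; split=> //; split=> //; exists x.
by split=> //; exists x => //; split=> //; rewrite -yE.
Qed.

Lemma prepend_disjoint a b E F : a != b ->
  prepend E [:: a] `&` prepend F [:: b] = set0.
Proof.
move=> /eqP ab; rewrite -subset0 => y [[_ [x _ ->]] [_ [z _]]].
by move=> /(@wcat_cons_inj _ a b)[].
Qed.

Lemma calU_prepend E w : calU X E -> calU X (prepend E w).
Proof.
suff U1 a F : calU X F -> calU X (prepend F [:: a]).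
  elim: w => [|a w IH] UE; first by rewrite prepend_nil.
  by rewrite prepend_cons; apply: U1; apply: IH.
have UC u v : language X u -> calU X (Cset X u (a :: v)).
  move=> Lu; have [Lv|nLv] := pselect (language X (a :: v)).
    exact: calU_Cset.
  by rewrite Cset_nonlanguage //; exact: calU_0.
move: F; apply: calU_ind => [|u v Lu Lv|E1 E2 _ _ U1 U2|E1 _ U1].
- by rewrite prependX; apply: UC; exact: language_nil.
- by rewrite prepend_Cset; exact: UC.
- by rewrite prependU; exact: calU_U.
- rewrite prependC prependX; apply: calU_D => //.
  by apply: UC; exact: language_nil.
Qed.

(** * Separating a set from its translates *)

Hypothesis hexit : forall (E : set (nat -> A)) (w : seq A),
  shift_cycle X E w -> has_exit E w.

Lemma separate_shift d E : d <> [::] -> calU X E -> E !=set0 ->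
  exists V, [/\ calU X V, V !=set0, V `<=` E &
    forall z, V z -> V (wcat d z) -> False].
Proof.
move=> d0 UE E0; have [ErE|/existsNP[x /not_implyP[Ex nEx]]] :=
  pselect (E `<=` relrange X E d); last first.
  exists (E `\` relrange X E d); split.
  - by apply: calU_D => //; exact: calU_relrange.
  - by exists x.
  - by move=> y [].
  - by move=> z [Ez nEz] [Edz _]; apply: nEz; split=> //; exact: calU_sub Ez.
(* If every point of E were d^infinity, the cycle (E, d) would have no exit. *)
have [w Ew wd] : exists2 w, E w & w <> winf d.
  apply: contrapT => H; have [x0 Ex0] := E0.
  have Ed y : E y -> y = winf d.
    by move=> Ey; apply: contrapT => yd; apply: H; exists y.
  apply: (@hexit E d).
    split=> //; have [_ Edx] := ErE _ Ex0.
    by apply: (@language_wcat d x0); exact: calU_sub Edx.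
  by apply/seteqP; split=> [y /Ed //|_ ->]; rewrite -(Ed _ Ex0).
(* If no power of d were the last one to begin w, then by induction all of them would, forcing w =
   d^infinity. *)
have [m wm wm1] : exists2 m, prepend X (wpow d m) w &
    ~ prepend X (wpow d m.+1) w.
  apply: contrapT => H; apply: wd; apply: wpow_winf => // n.
  have Xw := calU_sub UE Ew.
  suff [_ [x _ wE]] : prepend X (wpow d n) w by exists x.
  elim: n => [|n IH]; first by split=> //; exists w.
  by apply: contrapT => nH; apply: H; exists n.
exists ((E `&` prepend X (wpow d m)) `\` prepend X (wpow d m.+1)); split.
- apply: calU_D; last by apply: calU_prepend; exact: calU_T.
  by apply: calU_I => //; apply: calU_prepend; exact: calU_T.
- by exists w.
- by move=> y [[]].
(* z begins with d^m, so d z begins with d^(m+1), a prefix excluded from V. *)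
- move=> z [[_ [_ [x Xx zE]]] _] [[Edz _]]; apply; split.
    exact: calU_sub Edz.
  by exists x => //; rewrite /wpow /= wcat_cat -zE.
Qed.

(** Separation by f is done inside r(E, d); prefixing the result by d turns a conflict d z, d f z
    into the conflict z, f z that is already excluded. *)
Lemma separate_prefix d e f E : f <> [::] -> e = d ++ f ->
  calU X E -> (exists2 z, E (wcat d z) & E (wcat e z)) ->
  exists V, [/\ calU X V, V !=set0, V `<=` E &
    forall z, V (wcat d z) -> V (wcat e z) -> False].
Proof.
move=> f0 -> UE [z Edz _].
have [| |W [UW [x Wx] WE Wsep]] := @separate_shift f (relrange X E d) f0.
- exact: calU_relrange.
- by exists z; split=> //; apply: (@subshift_drop d); exact: calU_sub Edz.
exists (prepend W d); split.
- exact: calU_prepend.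
- exists (wcat d x); have [_ Edx] := WE _ Wx.
  by split; [exact: calU_sub Edx|exists x].
- by move=> y [_ [t /WE[_ Edt] ->]].
- move=> y [_ [t Wt /wcat_inj yt]] [_ [t' Wt']].
  rewrite wcat_cat => /wcat_inj yt'; subst t t'; exact: Wsep Wt Wt'.
Qed.

Lemma separate_words d e E : d <> e -> calU X E -> E !=set0 ->
  exists V, [/\ calU X V, V !=set0, V `<=` E &
    forall z, V (wcat d z) -> V (wcat e z) -> False].
Proof.
move=> de UE E0; have [[z Ed Ee]|H] :=
  pselect (exists2 z, E (wcat d z) & E (wcat e z)); last first.
  by exists E; split=> // z Ed Ee; apply: H; exists z.
have Xd := calU_sub UE Ed; have Xz := subshift_drop Xd.
have [[f dE]|nd] := pselect (exists f, d = e ++ f).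
  have f0 : f <> [::] by move=> f0; rewrite f0 cats0 in dE.
  have [|V [UV V0 VE H]] := separate_prefix f0 dE UE; first by exists z.
  by exists V; split=> // y Vd Ve; exact: H Ve Vd.
have [[f eE]|ne] := pselect (exists f, e = d ++ f).
  have f0 : f <> [::] by move=> f0; rewrite f0 cats0 in eE; apply: de.
  by apply: (separate_prefix f0 eE UE); exists z.
(* Neither word is a prefix of the other, so a point beginning with d cannot begin with e. *)
exists (E `&` prepend X d); split.
- by apply: calU_I => //; apply: calU_prepend; exact: calU_T.
- by exists (wcat d z); split=> //; split=> //; exists z.
- by move=> y [].
- move=> y _ [_ [_ [t _ /wcat_overlap[[f eE _]|[f dE _]]]]].
    by apply: ne; exists f.
  by apply: nd; exists f.
Qed.

(** A conflict in E makes a0 comparable with a, and b0 with b. In each case all conflicts have the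
    form x = d t, y = e t with fixed words d and e, so [separate_words] applies; d and e differ
    because neither pair of words extends the other by a common suffix. *)
Lemma separate_pairs (a0 b0 a b : seq A) E :
  ~ (exists2 f, a = a0 ++ f & b = b0 ++ f) ->
  ~ (exists2 f, a0 = a ++ f & b0 = b ++ f) ->
  calU X E -> E !=set0 ->
  exists V, [/\ calU X V, V !=set0, V `<=` E &
    forall x y z, V x -> V y -> wcat a0 x = wcat a z -> wcat b0 y = wcat b z ->
      False].
Proof.
move=> n1 n2 UE E0.
have [[x [y [z [Ex Ey axz byz]]]]|H] := pselect (exists x y z,
    [/\ E x, E y, wcat a0 x = wcat a z & wcat b0 y = wcat b z]); last first.
  by exists E; split=> // x y z *; apply: H; exists x, y, z.
have sep d e : d <> e -> (forall x' y' z', wcat a0 x' = wcat a z' ->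
    wcat b0 y' = wcat b z' -> exists2 t, wcat d t = x' & wcat e t = y') ->
  exists V, [/\ calU X V, V !=set0, V `<=` E &
    forall x y z, V x -> V y -> wcat a0 x = wcat a z -> wcat b0 y = wcat b z ->
      False].
  move=> de H; have [V [UV V0 VE Vsep]] := separate_words de UE E0.
  exists V; split=> // x' y' z' Vx Vy ax bz.
  have [t xE yE] := H _ _ _ ax bz; subst x' y'; exact: Vsep Vx Vy.
case: (wcat_overlap axz) => [[d aE zd]|[d aE xd]];
  case: (wcat_overlap byz) => [[e bE ze]|[e bE ye]]; subst.
(* Here d x = z = e y, so d and e are comparable too, and the shorter one can be cancelled. *)
- have de : d <> e by move=> de; apply: n2; exists d; rewrite // de.
  case: (wcat_overlap ze) => [[f dE yf]|[f eE xf]].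
    apply: (sep [::] f) => [f0|x' y' z'].
      by apply: de; rewrite dE -f0 cats0.
    rewrite !wcat_cat => /wcat_inj <- /wcat_inj; rewrite dE wcat_cat.
    by move=> /wcat_inj ->; exists x'.
  apply: (sep f [::]) => [f0|x' y' z'].
    by apply: de; rewrite eE f0 cats0.
  rewrite !wcat_cat => /wcat_inj <- /wcat_inj; rewrite eE wcat_cat.
  by move=> /wcat_inj <-; exists y'.
- apply: (sep [::] (e ++ d)) => [de0|x' y' z'].
    have [e0 d0] : e = [::] /\ d = [::].
      by move: de0; clear; case: e d => [|?] [].
    by apply: n1; exists [::]; rewrite ?e0 ?d0 ?cats0.
  rewrite !wcat_cat => /wcat_inj <- /wcat_inj ->.
  by exists x'; rewrite // wcat_cat.
- apply: (sep (d ++ e) [::]) => [de0|x' y' z'].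
    have [e0 d0] : d = [::] /\ e = [::].
      by move: de0; clear; case: d e => [|?] [].
    by apply: n1; exists [::]; rewrite ?e0 ?d0 ?cats0.
  rewrite !wcat_cat => /wcat_inj -> /wcat_inj <-.
  by exists y'; rewrite // wcat_cat.
- apply: (sep d e) => [de|x' y' z'].
    by apply: n1; exists d; rewrite // de.
  by rewrite !wcat_cat => /wcat_inj -> /wcat_inj ->; exists z'.
Qed.

End Sets.

(** * Compressions in the subshift algebra *)

Section Algebra.
Variables (A : pointedType) (X : set (nat -> A)) (R : comPzRingType).
Hypotheses (hX : subshift X) (X0 : X !=set0).
Hypothesis hletters : forall a, language X [:: a].
Implicit Types (a b : A) (u v w : seq A).
Implicit Types (E F V W : set (nat -> A)).

Local Notation Alg := (subshift_algebra R X).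
Local Notation rel := (@subshift_rel A R X).

(* p_E, with junk value 0 when E is not in calU X. *)
Definition pr E : Alg :=
  if pselect (calU X E) is left h then proj R h else 0.
Definition gs a : Alg := gen rel (GenS X a).
Definition gt a : Alg := gen rel (GenSs X a).
Definition ws w : Alg := foldr (fun a x => gs a * x) 1 w.
Definition wt w : Alg := foldr (fun a x => x * gt a) 1 w.

Lemma prE E (UE : calU X E) : pr E = proj R UE.
Proof.
by rewrite /pr; case: pselect => // UE'; congr proj; exact: Prop_irrelevance.
Qed.

Lemma cls_Sword w : cls rel (Sword R X w) = ws w.
Proof. by elim: w => //= a w <-; rewrite clsM. Qed.

Lemma cls_Ssword w : cls rel (Ssword R X w) = wt w.
Proof. by elim: w => //= a w <-; rewrite clsM. Qed.

Lemma cls_relE e e' : rel e e' -> cls rel e = cls rel e'.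
Proof. by move=> ee'; apply/clsE/teq_rel. Qed.

Lemma prT : pr X = 1.
Proof. by rewrite (prE (@calU_T A X)); exact: cls_relE (rel_projX _ _). Qed.

Lemma pr0 : pr set0 = 0.
Proof. by rewrite (prE (@calU_0 A X)); exact: cls_relE (rel_proj0 _ _). Qed.

Lemma prI E F : calU X E -> calU X F -> pr (E `&` F) = pr E * pr F.
Proof.
move=> UE UF; rewrite (prE (calU_I UE UF)) (prE UE) (prE UF).
by rewrite /proj /gen (cls_relE (rel_projI _ UE UF _)) clsM.
Qed.

Lemma prU E F : calU X E -> calU X F ->
  pr (E `|` F) = pr E + pr F - pr (E `&` F).
Proof.
move=> UE UF; rewrite (prE (calU_I UE UF)) (prE UE) (prE UF).
rewrite (prE (calU_U UE UF)) /proj /gen.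
by rewrite (cls_relE (rel_projU _ UE UF (calU_I UE UF) _)) !clsD clsN.
Qed.

Lemma pr_Cset u v : language X u -> language X v ->
  ws v * wt u * ws u * wt v = pr (Cset X u v).
Proof.
move=> Lu Lv; rewrite (prE (calU_Cset Lu Lv)) /proj /gen.
by rewrite -(cls_relE (rel_proj_Cset R _ Lu Lv)) !clsM !cls_Sword !cls_Ssword.
Qed.

Lemma gsts a : gs a * gt a * gs a = gs a.
Proof. by rewrite -[RHS](cls_relE (rel_SSsS _ _ a)) !clsM. Qed.

Lemma gtst a : gt a * gs a * gt a = gt a.
Proof. by rewrite -[RHS](cls_relE (rel_SsSSs _ _ a)) !clsM. Qed.

Lemma algZl k (x y : Alg) : (k *: x) * y = k *: (x * y).
Proof. by have [[_ _ _ + _] _ _] := presented_unital_algebra rel; apply. Qed.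

Lemma algZr k (x y : Alg) : x * (k *: y) = k *: (x * y).
Proof. by have [[_ _ _ _ +] _ _] := presented_unital_algebra rel; apply. Qed.

Lemma prC E F : calU X E -> calU X F -> pr E * pr F = pr F * pr E.
Proof. by move=> UE UF; rewrite -!prI // setIC. Qed.

Lemma prCC E : calU X E -> pr (X `\` E) = 1 - pr E.
Proof.
move=> UE; have UC := calU_C UE.
have := prU UC UE; rewrite setDKI pr0 subr0 setDKU ?prT => [->|].
  by rewrite addrK.
exact: calU_sub UE.
Qed.

Lemma pr_absorb E F : calU X E -> calU X F -> E `<=` F -> pr F * pr E = pr E.
Proof. by move=> UE UF EF; rewrite -prI // setIC (setIidl EF). Qed.

Lemma prD E F : calU X E -> calU X F -> E `<=` F -> pr (F `\` E) = pr F - pr E.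
Proof.
move=> UE UF EF; have -> : F `\` E = F `&` (X `\` E).
  by rewrite setIDA (setIidl (calU_sub UF)).
by rewrite prI ?prCC // ?mulrBr ?mulr1 ?pr_absorb //; exact: calU_C.
Qed.

(** * Moving projections past letters and words *)

Let Lnil : language X [::] := language_nil X0.
Let Upre w E : calU X E -> calU X (prepend X E w).
Proof. exact: calU_prepend. Qed.
Let Urel w E : calU X E -> calU X (relrange X E w).
Proof. exact: calU_relrange. Qed.
Let UT := @calU_T A X.

(** This is the defining relation for C(omega, a), applicable since [hletters] puts every letter in
    the language. *)
Lemma gs_gt a : gs a * gt a = pr (prepend X X [:: a]).
Proof.
rewrite prependX // -pr_Cset //=.
by rewrite !mulr1 !mul1r.
Qed.

Lemma gt_gs a : gt a * gs a = pr (relrange X X [:: a]).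
Proof.
rewrite relrangeX // -pr_Cset //=.
by rewrite !mulr1 !mul1r.
Qed.

Lemma gs_prX a : gs a * pr (relrange X X [:: a]) = gs a.
Proof. by rewrite -gt_gs mulrA gsts. Qed.

Lemma gs_pr a E : calU X E ->
  gs a * pr E = gs a * pr E * (gt a * gs a).
Proof.
by move=> UE; rewrite gt_gs -mulrA prC ?mulrA ?gs_prX //; exact: Urel.
Qed.

(** Induction over [calU]. Generators are covered by the relation for C(u, a v). For unions, s_a^*
    s_a is a projection that commutes with p_E and is absorbed by s_a from the right, so E -> s_a
    p_E s_a^* is multiplicative. *)
Lemma pr_prepend1 a E : calU X E ->
  pr (prepend X E [:: a]) = gs a * pr E * gt a.
Proof.
move: E; apply: calU_ind => [|u v Lu Lv|E F UE UF IE IF|E UE IE].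
- by rewrite prT mulr1 gs_gt.
- rewrite prepend_Cset //; have [Lav|nLav] := pselect (language X (a :: v)).
    by rewrite -!pr_Cset //= !mulrA.
  (* If a v is not in the language, no point of C(u, v) can be preceded by a within X, so the right
     side vanishes as well. *)
  rewrite Cset_nonlanguage // pr0 -gs_prX -[_ * pr (Cset _ _ _)]mulrA.
  rewrite -prI; [|exact: Urel|exact: calU_Cset].
  suff -> : relrange X X [:: a] `&` Cset X u v = set0.
    by rewrite pr0 mulr0 mul0r.
  rewrite -subset0 => y [[_ Xay] [x [yE _ _]]]; apply: nLav.
  by rewrite yE in Xay; exact: (@language_wcat _ _ _ x).
- have UaE := Upre [:: a] UE; have UaF := Upre [:: a] UF.
  rewrite prependU prU // prU // prI // IE IF prI //.
  rewrite !mulrDr !mulrDl mulrN mulNr.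
  congr (_ - _); rewrite [in RHS]mulrA [in RHS](gs_pr _ UE).
  by rewrite !mulrA.
- have UaE := Upre [:: a] UE; have UaX := Upre [:: a] UT.
  rewrite prependC prD //; last first.
    move=> y [Xy [x Ex yE]]; split=> //; exists x => //.
    exact: calU_sub Ex.
  by rewrite IE prCC // mulrBr mulrBl mulr1 gs_gt.
Qed.

(** Prefixing r(E, a) by a gives the points of E that begin with a; by [pr_prepend1] their
    projection is s_a p s_a^* with p that of r(E, a), and s_a s_a^* fixes s_a. *)
Lemma pr_gs a E : calU X E ->
  pr E * gs a = gs a * pr (relrange X E [:: a]).
Proof.
move=> UE; rewrite gs_pr; last exact: Urel.
rewrite mulrA -pr_prepend1; last exact: Urel.
rewrite prepend_relrange // prI //; last exact: Upre.
by rewrite -gs_gt -mulrA gsts.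
Qed.

Lemma gt_pr a E : calU X E ->
  gt a * pr E = pr (relrange X E [:: a]) * gt a.
Proof.
move=> UE; have Ur := Urel [:: a] UE; have UaX := Upre [:: a] UT.
rewrite -[gt a in LHS]gtst -!mulrA [gs a * _]mulrA gs_gt prC // -prI //.
rewrite -prepend_relrange // pr_prepend1 // !mulrA gt_gs pr_absorb //.
  exact: Urel.
by move=> y [Xy Eay]; split=> //; exact: calU_sub Eay.
Qed.

(** The range projections of s_a and s_b belong to disjoint sets, the points beginning with a and
    those beginning with b. *)
Lemma gt_gs0 a b : a != b -> gt a * gs b = 0.
Proof.
move=> ab; rewrite -[gt a]gtst -[gs b]gsts -!mulrA.
rewrite [gs a * _]mulrA [gs b * (gt b * _)]mulrA !gs_gt.
rewrite [pr _ * (pr _ * _)]mulrA -prI; [|exact: Upre|exact: Upre].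
by rewrite prepend_disjoint // pr0 mul0r mulr0.
Qed.

Lemma pr_ws w E : calU X E -> pr E * ws w = ws w * pr (relrange X E w).
Proof.
elim: w E => [|a w IH] E UE /=; first by rewrite relrange_nil // mulr1 mul1r.
by rewrite mulrA pr_gs // -mulrA IH ?mulrA -?relrange_cons //; exact: Urel.
Qed.

Lemma wt_pr w E : calU X E -> wt w * pr E = pr (relrange X E w) * wt w.
Proof.
elim: w E => [|a w IH] E UE /=; first by rewrite relrange_nil // mulr1 mul1r.
rewrite -mulrA gt_pr // mulrA IH ?mulrA; last exact: Urel.
by rewrite -relrange_cons.
Qed.

Lemma pr_prepend w E : calU X E -> pr (prepend X E w) = ws w * pr E * wt w.
Proof.
elim: w => [|a w IH] UE /=; first by rewrite prepend_nil // mulr1 mul1r.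
by rewrite prepend_cons // pr_prepend1 ?IH ?mulrA //; exact: Upre.
Qed.

Lemma relrange_mono E F w : E `<=` F -> relrange X E w `<=` relrange X F w.
Proof. by move=> EF y [Xy /EF]. Qed.

Lemma wt_ws w : wt w * ws w = pr (relrange X X w).
Proof.
elim: w => [|a w IH] /=; first by rewrite mulr1 relrange_nil // prT.
rewrite -mulrA [gt a * _]mulrA gt_gs pr_ws; last exact: Urel.
rewrite mulrA IH pr_absorb -?relrange_cons //; do ?exact: Urel.
rewrite relrange_cons //; apply: relrange_mono.
by move=> y [].
Qed.

Lemma ws_prX w : ws w * pr (relrange X X w) = ws w.
Proof. by rewrite -pr_ws // prT mul1r. Qed.

Lemma prX_wt w : pr (relrange X X w) * wt w = wt w.
Proof. by rewrite -wt_pr // prT mulr1. Qed.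

Lemma ws_pr w E : calU X E -> ws w * pr E = pr (prepend X E w) * ws w.
Proof.
move=> UE; rewrite pr_prepend // -mulrA wt_ws -mulrA prC ?mulrA ?ws_prX //.
exact: Urel.
Qed.

Lemma pr_wt w E : calU X E -> pr E * wt w = wt w * pr (prepend X E w).
Proof.
move=> UE; rewrite pr_prepend // !mulrA wt_ws prC -?mulrA ?prX_wt //.
exact: Urel.
Qed.

Lemma ws_cat u v : ws (u ++ v) = ws u * ws v.
Proof. by elim: u => [|a u IH] /=; rewrite ?mul1r // IH mulrA. Qed.

Lemma wt_cat u v : wt (u ++ v) = wt v * wt u.
Proof. by elim: u => [|a u IH] /=; rewrite ?mulr1 // IH mulrA. Qed.

(** * Diagonal elements: linear combinations of projections *)

Inductive diag : Alg -> Prop :=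
| diag0 : diag 0
| diagS k E d : calU X E -> diag d -> diag (k *: pr E + d).

Lemma diag_pr E : calU X E -> diag (pr E).
Proof.
move=> UE; rewrite -[pr E]addr0 -[pr E]scale1r.
by apply: diagS => //; exact: diag0.
Qed.

Lemma diagD d e : diag d -> diag e -> diag (d + e).
Proof.
move=> + De; elim=> [|k E d' UE _ IH]; first by rewrite add0r.
by rewrite -addrA; exact: diagS.
Qed.

Lemma diagZ k d : diag d -> diag (k *: d).
Proof.
elim=> [|l E d' UE _ IH]; rewrite ?scaler0; first exact: diag0.
by rewrite scalerDr scalerA; exact: diagS.
Qed.

Lemma diag_mul E d : calU X E -> diag d -> diag (pr E * d).
Proof.
move=> UE; elim=> [|l F d' UF _ IH]; rewrite ?mulr0; first exact: diag0.
by rewrite mulrDr algZr -prI //; apply: diagS => //; exact: calU_I.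
Qed.

Lemma diagC E d : calU X E -> diag d -> pr E * d = d * pr E.
Proof.
move=> UE; elim=> [|l F d' UF _ IH]; rewrite ?mulr0 ?mul0r //.
by rewrite mulrDr mulrDl IH algZr algZl prC.
Qed.

Lemma diag_conj w d : diag d -> diag (ws w * d * wt w).
Proof.
elim=> [|l F d' UF _ IH]; rewrite ?mulr0 ?mul0r; first exact: diag0.
rewrite mulrDr mulrDl algZr algZl -pr_prepend //.
by apply: diagS => //; exact: Upre.
Qed.

Lemma gt_diag a d : diag d -> exists2 d', diag d' & gt a * d = d' * gt a.
Proof.
elim=> [|l F d' UF _ [e De eE]].
  by exists 0; rewrite ?mulr0 ?mul0r //; exact: diag0.
exists (l *: pr (relrange X F [:: a]) + e).
  by apply: diagS => //; exact: Urel.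
by rewrite mulrDr mulrDl algZr algZl gt_pr // eE.
Qed.

(* The constant c absorbs the coefficients of the projections already reduced
   to the identity on the current set W. *)
Lemma diag_atom d : diag d -> forall (c : R) W, calU X W ->
  pr W * (c *: (1 : Alg) + d) <> 0 ->
  exists E (k : R), [/\ calU X E, E !=set0, E `<=` W, k != 0 &
    pr E * (c *: (1 : Alg) + d) = k *: pr E].
Proof.
elim=> [|k F {}d UF Dd IH] c W UW.
  rewrite addr0 algZr mulr1 => W0; exists W, c; split=> //.
    by apply/set0P/eqP => W1; apply: W0; rewrite W1 pr0 scaler0.
    by apply/eqP => c0; apply: W0; rewrite c0 scale0r.
  by rewrite algZr mulr1.
have UC := calU_C UF; have UI := calU_I UW UF; have UD := calU_I UW (calU_C UF).
(* W is split along F: inside F the coefficient k joins the constant c, outside F the summand k p_F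
   disappears. One of the halves keeps the product nonzero. *)
have prW : pr W = pr (W `&` F) + pr (W `&` (X `\` F)).
  by rewrite (prI UW UF) (prI UW UC) prCC // -mulrDr addrC subrK mulr1.
have inF E : calU X E -> E `<=` W `&` F ->
    pr E * (c *: (1 : Alg) + (k *: pr F + d)) =
    pr E * ((c + k) *: (1 : Alg) + d).
  move=> UE EF; rewrite addrA !mulrDr scalerDl !mulrDr !algZr mulr1.
  by rewrite [pr E * pr F]prC // pr_absorb // => y /EF[].
have outF E : calU X E -> E `<=` W `&` (X `\` F) ->
    pr E * (c *: (1 : Alg) + (k *: pr F + d)) = pr E * (c *: (1 : Alg) + d).
  move=> UE EF; rewrite !mulrDr !algZr -prI //.
  suff -> : E `&` F = set0 by rewrite pr0 scaler0 add0r.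
  by rewrite -subset0 => y [/EF[_ []]].
rewrite prW mulrDl; have [->|/eqP nz _] :=
    eqVneq (pr (W `&` F) * (c *: (1 : Alg) + (k *: pr F + d))) 0.
  rewrite add0r => nz.
  have [|E [l [UE E0 EW l0 El]]] := IH c _ UD; first by rewrite -outF.
  by exists E, l; split=> //; [move=> y /EW[]|rewrite outF].
have [|E [l [UE E0 EW l0 El]]] := IH (c + k) _ UI; first by rewrite -inF.
by exists E, l; split=> //; [move=> y /EW[]|rewrite inF].
Qed.

(** * Spanning by monomials *)

Local Notation triple := (seq A * seq A * Alg)%type.
Implicit Types (p q : triple) (L : seq triple).

Definition monomial p : Alg := ws p.1.1 * p.2 * wt p.1.2.

Definition span (x : Alg) :=
  exists2 L, {in L, forall p, diag p.2} & x = \sum_(p <- L) monomial p.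

Lemma span_monomial u v d : diag d -> span (ws u * d * wt v).
Proof.
move=> Dd; exists [:: (u, v, d)]; last by rewrite big_seq1.
by move=> p; rewrite inE => /eqP ->.
Qed.

Lemma span0 : span 0.
Proof. by exists [::]; rewrite ?big_nil. Qed.

Lemma spanD x y : span x -> span y -> span (x + y).
Proof.
move=> [L1 D1 ->] [L2 D2 ->]; exists (L1 ++ L2); last by rewrite big_cat.
by move=> p; rewrite mem_cat => /orP[/D1|/D2].
Qed.

Lemma span_map (f : Alg -> Alg) : {morph f : x y / x + y} -> f 0 = 0 ->
  (forall u v d, diag d -> span (f (ws u * d * wt v))) ->
  forall x, span x -> span (f x).
Proof.
move=> fD f0 fm x [L DL ->]; rewrite (big_morph f fD f0) big_seq.
elim/big_ind: _ => [||p /DL]; [exact: span0|exact: spanD|exact: fm].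
Qed.

Lemma spanZ k x : span x -> span (k *: x).
Proof.
apply: span_map; [exact: scalerDr|exact: scaler0|] => u v d Dd.
by rewrite -algZl -algZr; apply/span_monomial/diagZ.
Qed.

Lemma span_pr E x : calU X E -> span x -> span (pr E * x).
Proof.
move=> UE; apply: span_map; [exact: mulrDr|exact: mulr0|] => u v d Dd.
rewrite !mulrA pr_ws // -[ws u * _ * d]mulrA; apply: span_monomial.
by apply: diag_mul => //; exact: Urel.
Qed.

Lemma span_gs a x : span x -> span (gs a * x).
Proof.
apply: span_map; [exact: mulrDr|exact: mulr0|] => u v d Dd.
by rewrite !mulrA; exact: (@span_monomial (a :: u)).
Qed.

Lemma span_gt a x : span x -> span (gt a * x).
Proof.
apply: span_map; [exact: mulrDr|exact: mulr0|] => [[|b u] v d Dd] /=.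
  have [e De eE] := gt_diag a Dd; rewrite mul1r mulrA eE.
  (* Having passed the diagonal coefficient, s_a^* joins the starred word: s_a^* s_v^* is the
     starred word of v a. *)
  have -> : e * gt a * wt v = ws [::] * e * wt (rcons v a).
    by rewrite -cats1 wt_cat /= !mul1r mulrA.
  exact: span_monomial.
have [->|ab] := eqVneq a b; last first.
  by rewrite !mulrA gt_gs0 // !mul0r; exact: span0.
rewrite -!mulrA [gt b * _]mulrA gt_gs; apply: span_pr; first exact: Urel.
by rewrite mulrA; exact: span_monomial.
Qed.

(** The span contains 1 = p_X and absorbs left multiplication by every generator, hence by every
    formal expression. *)
Lemma span_all x : span x.
Proof.
suff spanM e y : span y -> span (cls rel e * y).
  rewrite -[x]mulr1 -(cls_repr x); apply: spanM.
  rewrite -prT -[pr X]mulr1 -[pr X]mul1r.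
  by apply: (@span_monomial [::] [::]); exact: diag_pr.
elim: e y => [[E UE|a|a]|||e IH|e IHe f IHf|e IHe f IHf|k e IH] y Sy.
- by have := span_pr UE Sy; rewrite prE.
- exact: span_gs.
- exact: span_gt.
- by have := span0; rewrite -[0](mul0r y).
- by rewrite [_ * _]mul1r.
- rewrite clsN [_ * _]mulNr -scaleN1r; apply: spanZ; exact: IH.
- by rewrite clsD [_ * _]mulrDl; apply: spanD; [exact: IHe|exact: IHf].
- by rewrite clsM -[_ * _]mulrA; apply/IHe/IHf.
- by rewrite clsZ [_ * _]algZl; apply/spanZ/IH.
Qed.

(** * Cutting away all but one monomial *)

Hypothesis hexit : forall E w, shift_cycle X E w -> has_exit E w.

(** Since p_V = p_W p_V, a summand once killed stays killed when the set shrinks further; this lets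
    [cut_sum] treat the summands one after another. *)
Lemma cut_sub V W (x : Alg) : calU X V -> calU X W -> V `<=` W ->
  pr W * x * pr W = 0 -> pr V * x * pr V = 0.
Proof.
move=> UV UW VW W0; rewrite -(pr_absorb UV UW VW) [in pr W * pr V * x]prC //.
by rewrite -!mulrA [x * (pr W * _)]mulrA [pr W * (_ * _)]mulrA
  [pr W * (x * _)]mulrA W0 mul0r mulr0.
Qed.

Lemma cut_sum (I : eqType) (s : seq I) (f : I -> Alg) :
  (forall i E, i \in s -> calU X E -> E !=set0 ->
    exists V, [/\ calU X V, V !=set0, V `<=` E & pr V * f i * pr V = 0]) ->
  forall E, calU X E -> E !=set0 ->
  exists V, [/\ calU X V, V !=set0, V `<=` E &
    pr V * (\sum_(i <- s) f i) * pr V = 0].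
Proof.
elim: s => [|i s IH] H E UE E0.
  by exists E; split=> //; rewrite big_nil mulr0 mul0r.
have [j F js|V [UV V0 VE Vs]] := IH _ E UE E0.
  by apply: H; rewrite in_cons js orbT.
have [|W [UW W0 WV Wi]] := H i V _ UV V0; first exact: mem_head.
exists W; split=> //; first exact: subset_trans VE.
by rewrite big_cons mulrDr mulrDl Wi (cut_sub UW UV WV Vs) addr0.
Qed.

(** For such index pairs, conjugating the coefficient of q by s_f makes it a diagonal coefficient at
    the indices of p, so the two monomials merge. When neither triple extends the other,
    [separate_pairs] applies. *)
Definition extends p q := exists2 f, q.1.1 = p.1.1 ++ f & q.1.2 = p.1.2 ++ f.

(** Moving both copies of p_V inward past the words brings together the projections of r(a0 V, a)
    and r(b0 V, b). A common point z would give a0 x = a z and b0 y = b z with x, y in V, which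
    separation forbids. *)
Lemma cut_monomial p q E : diag q.2 -> ~ extends p q -> ~ extends q p ->
  calU X E -> E !=set0 ->
  exists V, [/\ calU X V, V !=set0, V `<=` E &
    pr V * (wt p.1.1 * monomial q * ws p.1.2) * pr V = 0].
Proof.
case: p q => [[a0 b0] d0] [[a b] d] /= Dd pq qp UE E0.
have [V [UV V0 VE sep]] := separate_pairs hX X0 hexit pq qp UE E0.
exists V; split=> //; rewrite /monomial /=.
have Ua := Upre a0 UV; have Ub := Upre b0 UV.
have Ura := Urel a Ua; have Urb := Urel b Ub.
have -> : pr V * (wt a0 * (ws a * d * wt b) * ws b0) * pr V =
    (pr V * wt a0) * ws a * d * (wt b * (ws b0 * pr V)) by rewrite !mulrA.
rewrite (pr_wt a0 UV) (ws_pr b0 UV) [wt b * _]mulrA (wt_pr b Ub).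
rewrite -[wt a0 * _ * _]mulrA (pr_ws a Ua) -!mulrA [d * _]mulrA -diagC //.
rewrite !mulrA -[_ * pr _ * pr _]mulrA -prI //.
suff -> : relrange X (prepend X V a0) a `&`
    relrange X (prepend X V b0) b = set0.
  by rewrite pr0 mulr0 !mul0r.
rewrite -subset0 => z [[_ [_ [x Vx ax]]] [_ [_ [y Vy ay]]]].
exact: sep Vx Vy (esym ax) (esym ay).
Qed.

Lemma monomial_merge p q : extends p q ->
  monomial p + monomial q =
  monomial (p.1, p.2 + ws (drop (size p.1.1) q.1.1) * q.2 *
                       wt (drop (size p.1.1) q.1.1)).
Proof.
case: p q => [[a b] d] [[a' b'] e] [f /= -> ->].
rewrite /monomial /= drop_size_cat // ws_cat wt_cat mulrDr mulrDl.
by rewrite !mulrA.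
Qed.

Lemma cut_to_pr L : {in L, forall p, diag p.2} ->
  \sum_(p <- L) monomial p <> 0 ->
  exists (x y : Alg) (k : R) E, [/\ calU X E, E !=set0, k != 0 &
    x * (\sum_(p <- L) monomial p) * y = k *: pr E].
Proof.
have [n] := ubnP (size L); elim: n L => // n IH L sL DL L0.
have [p pL /eqP p0] : exists2 p, p \in L & monomial p != 0.
  apply: contrapT => H; apply: L0; rewrite big_seq big1 // => p pL.
  by apply/eqP; apply: contrapT => /negP p0; apply: H; exists p.
have Lp := perm_to_rem pL.
have sum_perm L' : perm_eq L L' ->
    \sum_(t <- L) monomial t = \sum_(t <- L') monomial t by exact: perm_big.
(* Merging two comparable monomials shortens the list, so the induction hypothesis applies;
   afterwards p may be assumed incomparable with all the others. *)
have merge q r L' : perm_eq L (q :: r :: L') -> extends q r ->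
    exists (x y : Alg) (k : R) E, [/\ calU X E, E !=set0, k != 0 &
      x * (\sum_(p <- L) monomial p) * y = k *: pr E].
  move=> LL' qr; rewrite (sum_perm _ LL') !big_cons addrA monomial_merge //.
  have DL' : {in q :: r :: L', forall p, diag p.2}.
    by move=> t; rewrite -(perm_mem LL'); exact: DL.
  set m := (_, _); have mE : monomial m + \sum_(t <- L') monomial t =
      \sum_(t <- m :: L') monomial t by rewrite big_cons.
  rewrite mE; apply: IH.
  - by move: sL; rewrite (perm_size LL').
  - move=> t; rewrite in_cons => /orP[/eqP ->|tL] /=; last first.
      by apply: DL'; rewrite !in_cons tL !orbT.
    apply: diagD; first by apply: DL'; rewrite mem_head.
    by apply/diag_conj/DL'; rewrite !in_cons eqxx orbT.
  - rewrite -mE -monomial_merge // -addrA.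
    by move: L0; rewrite (sum_perm _ LL') !big_cons.
have [[q qL pq]|nm] := pselect (exists2 q, q \in rem p L &
    extends p q \/ extends q p).
  have Lpq : perm_eq L (p :: q :: rem q (rem p L)).
    by apply: (perm_trans Lp); rewrite perm_cons perm_to_rem.
  case: pq => [pq|qp]; first exact: merge Lpq pq.
  apply: merge qp; apply: (perm_trans Lpq).
  by rewrite -[p :: _]/([:: p] ++ [:: q] ++ _) perm_catCA; exact: perm_refl.
(* With (u, v) the index of p, this is diagonal because s_u^* s_u and s_v^* s_v are projections. *)
pose D0 := wt p.1.1 * monomial p * ws p.1.2.
have D0E : D0 = pr (relrange X X p.1.1) * (pr (relrange X X p.1.2) * p.2).
  rewrite [pr (relrange X X p.1.2) * _]diagC; [|exact: Urel|exact: DL].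
  by rewrite -!wt_ws /D0 /monomial !mulrA.
have DD0 : diag D0.
  by rewrite D0E; do 2![apply: diag_mul; first exact: Urel]; exact: DL.
(* The search starts from all of X with no coefficient absorbed. [D0] is nonzero because multiplying
   back by s_u and s_v^* recovers the monomial. *)
have [|E [k [UE E0 _ k0 Ek]]] := diag_atom DD0 (c := 0) UT.
  rewrite scale0r add0r prT mul1r => D00; apply: p0.
  have : ws p.1.1 * D0 * wt p.1.2 = monomial p.
    rewrite D0E [pr (relrange X X p.1.2) * _]diagC; [|exact: Urel|exact: DL].
    by rewrite !mulrA ws_prX -!mulrA prX_wt mulrA.
  by rewrite D00 mulr0 mul0r.
rewrite scale0r add0r in Ek.
(* The other monomials are killed by shrinking E to V, where [D0] still acts as the scalar k. *)
have [q E' qL UE' E'0|V [UV V0 VE V00]] :=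
  @cut_sum _ (rem p L) (fun q => wt p.1.1 * monomial q * ws p.1.2) _ E UE E0.
  apply: cut_monomial => //; first by apply: DL; exact: mem_rem qL.
    by move=> pq; apply: nm; exists q => //; left.
  by move=> pq; apply: nm; exists q => //; right.
exists (pr V * wt p.1.1), (ws p.1.2 * pr V), k, V; split=> //.
rewrite (sum_perm _ Lp) big_cons mulrDr mulrDl.
rewrite -mulr_suml -mulr_sumr in V00.
rewrite -[RHS]addr0 -[in RHS]V00; congr (_ + _); last by rewrite !mulrA.
have -> : pr V * wt p.1.1 * monomial p * (ws p.1.2 * pr V) = pr V * D0 * pr V.
  by rewrite /D0 !mulrA.
rewrite -(pr_absorb UV UE VE) prC // -[pr V * pr E * D0]mulrA Ek algZr algZl.
by rewrite -prC // !pr_absorb // -prI // setIid.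
Qed.

End Algebra.

(** * Injectivity of the homomorphism *)

Unset Implicit Arguments.

Theorem theorem5p1 (A : pointedType) (X : set (nat -> A)) (R : comPzRingType)
    (hX : subshift X)
    (hletters : X !=set0 -> forall a : A, language X [:: a])
    (hexit : forall (E : set (nat -> A)) (alpha : seq A),
       shift_cycle X E alpha -> has_exit E alpha)
    (B : lmodType R) (mulB : B -> B -> B) (hB : algebra_law mulB)
    (Phi : {linear subshift_algebra R X -> B})
    (hPhi : {morph Phi : x y / x * y >-> mulB x y})
    (hp : forall (E : set (nat -> A)) (hE : calU X E) (gamma : R),
       E !=set0 -> gamma != 0 -> Phi (gamma *: proj R hE) != 0) :
  injective Phi.
Proof.
suff ker x : Phi x = 0 -> x = 0.
  move=> x y xy; apply/eqP; rewrite -subr_eq0; apply/eqP/ker.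
  by rewrite linearB xy subrr.
move=> Px; have [X0|X0] := pselect (X !=set0); last first.
  (* For empty X the projection of X is both 1 and 0, so the algebra is zero. *)
  have XE : X = set0 by apply/eqP; apply: contrapT => /negP/set0P.
  have T0 : pr X R X = pr X R set0 by congr pr.
  by rewrite -[x]mul1r -prT T0 pr0 mul0r.
have hL := hletters X0.
have [L DL xE] := span_all hX X0 hL x.
apply: contrapT => x0; rewrite xE in x0.
have [y [z [k [E [UE E0 k0 yz]]]]] := cut_to_pr hX X0 hL hexit DL x0.
have /eqP := hp E UE k E0 k0; apply.
(* Zero is written as [Phi 0], so that the products with zero are evaluated in the subshift algebra
   rather than through [mulB]. *)
by rewrite -prE -yz -xE !hPhi Px -[0](linear0 Phi) -!hPhi mulr0 mul0r.
Qed.
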